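(* Let $\mathbbm{k}$ be a field of characteristic $0$, $N \geqslant 3$, and let $I$ be the defining ideal of a general set of $s$ points in $\mathbb{P}^N_{\mathbbm{k}}$ (for any $s \geqslant 1$). Then for all $m \in \mathbb{N}$, $$\frac{\alpha(I^{(m)})}{m} \geqslant \frac{\alpha(I)+N-2}{N}.$$
   Context: $\alpha(J)$ is the least degree of a nonzero homogeneous element of a homogeneous ideal $J$. For the ideal $I$ of points with point ideals $\mathfrak{p}_1,\dots,\mathfrak{p}_s$, $I^{(m)} = \bigcap_i \mathfrak{p}_i^m$. A property holds for a general set of $s$ points in $\mathbb{P}^N_{\mathbbm{k}}$ if there is a nonempty Zariski open subset $U$ of the parameter space of $s$ points (e.g. of $\mathbb{A}^{s(N+1)}_{\mathbbm{k}}$, with $\mathbf{a}=(a_{ij})$ giving the points $[a_{i0}:\dots:a_{iN}]$) such that the property holds for every set of points corresponding to a point of $U$. *)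

(* Defs.v *)
From HB Require Import structures.
From mathcomp Require Import all_boot all_order all_algebra.
From mathcomp Require Import mpoly.
From Stdlib Require Import ClassicalEpsilon.

Set Implicit Arguments.
Unset Strict Implicit.
Unset Printing Implicit Defensive.

Import Order.TTheory GRing.Theory Num.Theory.
Local Open Scope ring_scope.

Section Defs.
Variable k : fieldType.

Definition ideal_gen (n : nat) (S : {mpoly k[n]} -> Prop) : {mpoly k[n]} -> Prop :=
  fun f => exists (l : nat) (c g : 'I_l -> {mpoly k[n]}),
    (forall i, S (g i)) /\ f = \sum_(i < l) c i * g i.

Definition prod_set (n : nat) (P : {mpoly k[n]} -> Prop) (m : nat) : {mpoly k[n]} -> Prop :=
  fun f => exists g : 'I_m -> {mpoly k[n]},
    (forall i, P (g i)) /\ f = \prod_(i < m) g i.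

Definition ideal_pow (n : nat) (P : {mpoly k[n]} -> Prop) (m : nat) : {mpoly k[n]} -> Prop :=
  ideal_gen (prod_set P m).

(* The (homogeneous) ideal of the projective point [a_0 : ... : a_{n-1}]:
   polynomials all of whose homogeneous components vanish at a. *)
Definition point_ideal (n : nat) (a : 'I_n -> k) : {mpoly k[n]} -> Prop :=
  fun f => forall d : nat, (pihomog mdeg d f).@[a] = 0.

(* alpha(J): least degree of a nonzero homogeneous element of J (0 if none). *)
Definition alpha_pred (n : nat) (J : {mpoly k[n]} -> Prop) : pred nat :=
  fun d => if excluded_middle_informative
                (exists f : {mpoly k[n]}, J f /\ f != 0 /\ f \is d.-homog)
           then true else false.

Definition alpha (n : nat) (J : {mpoly k[n]} -> Prop) : nat :=
  match excluded_middle_informative (exists d, alpha_pred J d) with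
  | left h => ex_minn h
  | right _ => 0%N
  end.

(* Parameter space A^{s(N+1)}: a : 'I_(s*(N+1)) -> k; the i-th point is
   [a_{i0} : ... : a_{iN}]. *)
Definition pt (s N : nat) (a : 'I_(s * N.+1) -> k) (i : 'I_s) : 'I_N.+1 -> k :=
  fun j => a (mxvec_index i j).

Definition points_ideal (s N : nat) (a : 'I_(s * N.+1) -> k) : {mpoly k[N.+1]} -> Prop :=
  fun f => forall i : 'I_s, point_ideal (pt a i) f.

Definition sym_pow (s N : nat) (a : 'I_(s * N.+1) -> k) (m : nat) : {mpoly k[N.+1]} -> Prop :=
  fun f => forall i : 'I_s, ideal_pow (point_ideal (pt a i)) m f.

Definition zariski_open (M : nat) (U : ('I_M -> k) -> Prop) : Prop :=
  exists S : {mpoly k[M]} -> Prop,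
    forall v, U v <-> exists g, S g /\ g.@[v] != 0.

Definition general_points (s N : nat) (Prop_ : ('I_(s * N.+1) -> k) -> Prop) : Prop :=
  exists U : ('I_(s * N.+1) -> k) -> Prop,
    zariski_open U /\ (exists v, U v) /\ forall a, U a -> Prop_ a.

End Defs.

(* Main.v *)
(** The bound comes from star configurations, Frobenius and reduction modulo a
    large prime.

    Let [d] be such that ['C(d + N, N) <= s < 'C(d.+1 + N, N)] and put
    [l = d + N].  Linear algebra gives [alpha I <= d + 1] for all points, so it
    suffices to bound [alpha (I^(m)) / m] below by [(l - 1) / N].

    The ['C(l, N)] points in which [N] out of [l] hyperplanes in general position
    meet satisfy [alpha (I^(m)) / m >= l / N]: restrict a form to one of the
    hyperplanes, or divide by its equation.  For one fixed [m0] this persists on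
    the open set where a maximal minor of the interpolation matrix is nonzero.

    To pass from [m0] to all [m], specialize the points and a form of [I^(m)] to
    an algebraically closed field of large characteristic [p], keeping that minor
    nonzero.  There every polynomial is [\sum_b f_b^p X^b] with exponents
    [b < p], and if it vanishes to order [p * (m0 + N + 1)] at a point, then each
    [f_b] vanishes to order [m0].  Applied to powers of the form this yields
    [alpha (I^(m)) / m >= alpha (I^(m0)) / (m0 + N + 1)], and the right-hand side
    is at least [(l - 1) / N] for [m0 = (l - 1) * (N + 1)]. *)

Require Import Defs.
From HB Require Import structures.
From mathcomp Require Import all_boot all_order all_algebra.
From mathcomp Require Import closed_field mpoly.
From mathcomp Require Import zify ring.
From Stdlib Require Import ClassicalEpsilon.

Set Implicit Arguments.
Unset Strict Implicit.
Unset Printing Implicit Defensive.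

Import Order.TTheory GRing.Theory Num.Theory.
Local Open Scope ring_scope.

(** * Substitution into multivariate polynomials *)

Lemma eq_mmap (n : nat) (R S : nzRingType) (f f' : R -> S) (h h' : 'I_n -> S)
  (p : {mpoly R[n]}) : f =1 f' -> h =1 h' -> mmap f h p = mmap f' h' p.
Proof.
move=> ff' hh'; rewrite /mmap; apply: eq_bigr => u _.
by rewrite ff' (mmap1_eq _ hh').
Qed.

Lemma rmorph_mmap (n : nat) (R S T : nzRingType) (phi : {rmorphism S -> T})
  (f : R -> S) (h : 'I_n -> S) (p : {mpoly R[n]}) :
  phi (mmap f h p) = mmap (phi \o f) (phi \o h) p.
Proof.
rewrite /mmap rmorph_sum; apply: eq_bigr => u _; rewrite rmorphM; congr (_ * _).
by rewrite /mmap1 rmorph_prod; apply: eq_bigr => i _; rewrite rmorphXn.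
Qed.

Section Substitution.
Variables (R : comNzRingType).

Definition msubst (n n' : nat) (h : 'I_n -> {mpoly R[n']}) (p : {mpoly R[n]})
  : {mpoly R[n']} := mmap (@mpolyC n' R) h p.

HB.instance Definition _ n n' h :=
  GRing.RMorphism.copy (@msubst n n' h) (mmap (@mpolyC n' R) h).

Lemma msubstC n n' (h : 'I_n -> {mpoly R[n']}) c : msubst h c%:MP = c%:MP.
Proof. exact: mmapC. Qed.

Lemma msubstXU n n' (h : 'I_n -> {mpoly R[n']}) i : msubst h 'X_i = h i.
Proof. by rewrite /msubst mmapX mmap1U. Qed.

Lemma msubstZ n n' (h : 'I_n -> {mpoly R[n']}) c p :
  msubst h (c *: p) = c *: msubst h p.
Proof. by rewrite /msubst mmapZ mul_mpolyC. Qed.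

Lemma msubst_comp n1 n2 n3 (h : 'I_n1 -> {mpoly R[n2]})
    (h' : 'I_n2 -> {mpoly R[n3]}) p :
  msubst h' (msubst h p) = msubst (fun i => msubst h' (h i)) p.
Proof.
rewrite {2}/msubst rmorph_mmap; apply: eq_mmap => // c /=.
exact: msubstC.
Qed.

Lemma eq_msubst n n' (h h' : 'I_n -> {mpoly R[n']}) p :
  h =1 h' -> msubst h p = msubst h' p.
Proof. by move=> hh'; apply: eq_mmap. Qed.

Lemma msubst_id n (p : {mpoly R[n]}) : msubst (fun i => 'X_i) p = p.
Proof.
rewrite {2}[p]mpolyE /msubst /mmap; apply: eq_bigr => u _.
by rewrite mmap1_id mul_mpolyC.
Qed.

Lemma dhomog_msubst n n' (h : 'I_n -> {mpoly R[n']}) p d :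
  (forall i, h i \is 1.-homog) -> p \is d.-homog -> msubst h p \is d.-homog.
Proof.
move=> hh /dhomogP hp; rewrite /msubst /mmap big_seq.
apply: rpred_sum => u /hp /= <-; rewrite mul_mpolyC; apply: rpredZ.
rewrite mdegE /mmap1.
elim/big_ind2: _ => [|x1 x2 y1 y2 H1 H2|i _]; first exact: dhomog1.
  by rewrite addnC mulrC; apply: dhomogM.
by have := dhomogMn (u i) (hh i); rewrite mul1n.
Qed.

(** Products of congruent factors are congruent, which leaves powers of variables, where [x - y]
    divides [x ^+ i - y ^+ i]. With [l] the equation of a hyperplane, this will turn vanishing on it
    into divisibility. *)
Lemma msubst_congr n n' (l : {mpoly R[n']}) (h h' : 'I_n -> {mpoly R[n']}) p :
    (forall i, exists q, h i - h' i = l * q) ->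
  exists q, msubst h p - msubst h' p = l * q.
Proof.
move=> hh; elim/mpolyind: p => [|c u p _ _ [q Eq]].
  by exists 0; rewrite !rmorph0 subrr mulr0.
suff [q' Eq'] : exists q', msubst h 'X_[u] - msubst h' 'X_[u] = l * q'.
  exists (c *: q' + q); rewrite !rmorphD /= !msubstZ opprD addrACA Eq.
  by rewrite -scalerBr Eq' mulrDr scalerAr.
rewrite mpolyXE_id !rmorph_prod.
elim/big_ind2: _ => [|x2 x1 y2 y1 [q1 E1] [q2 E2]|i _].
- by exists 0; rewrite subrr mulr0.
- exists (q1 * y1 + x2 * q2).
  by rewrite mulrDr mulrA -E1 mulrCA -E2; ring.
- have [r Ei] := hh i; rewrite !rmorphXn /= !msubstXU subrXX Ei.
  by eexists; rewrite -mulrA.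
Qed.

End Substitution.

(** * Order of vanishing at a point *)

Section Order.
Variables (R : comNzRingType).

Definition ordge n (p : {mpoly R[n]}) (m : nat) :=
  forall u : 'X_{1..n}, (mdeg u < m)%N -> p@_u = 0.

Lemma ordge0 n m : ordge (0 : {mpoly R[n]}) m.
Proof. by move=> u _; rewrite mcoeff0. Qed.

Lemma ordgeW n (p : {mpoly R[n]}) m m' : (m' <= m)%N -> ordge p m -> ordge p m'.
Proof. by move=> le_m hp u lt_u; apply: hp; apply: leq_trans le_m. Qed.

Lemma ordge_sum n (I : eqType) (r : seq I) (P : pred I) (F : I -> {mpoly R[n]}) m :
  (forall i, i \in r -> P i -> ordge (F i) m) -> ordge (\sum_(i <- r | P i) F i) m.
Proof.
move=> hF u lt_u; rewrite raddf_sum big_seq_cond; apply: big1 => i /andP[ri Pi].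
exact: hF.
Qed.

Lemma ordgeM n (p q : {mpoly R[n]}) m m' :
  ordge p m -> ordge q m' -> ordge (p * q) (m + m').
Proof.
move=> hp hq u lt_u; rewrite mcoeffM; apply: big1 => -[v w] /= /eqP Eu.
have [lt_v|le_v] := ltnP (mdeg v) m; first by rewrite hp ?mul0r.
have Edeg := congr1 mdeg Eu; rewrite mdegD in Edeg.
by rewrite hq ?mulr0 //; lia.
Qed.

Lemma ordgeMl n (p q : {mpoly R[n]}) m : ordge p m -> ordge (q * p) m.
Proof. by move=> hp; rewrite -[m]add0n; apply: ordgeM. Qed.

Lemma ordgeX n (p : {mpoly R[n]}) m j : ordge p m -> ordge (p ^+ j) (m * j).
Proof.
move=> hp; elim: j => [|j IHj]; first by rewrite muln0.
by rewrite exprS mulnS; apply: ordgeM.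
Qed.

Lemma ordge_mmap1 n n' (h : 'I_n -> {mpoly R[n']}) (u : 'X_{1..n}) :
  (forall i, ordge (h i) 1) -> ordge (mmap1 h u) (mdeg u).
Proof.
move=> hh; rewrite mdegE /mmap1.
elim/big_ind2: _ => [//|x1 x2 y1 y2 H1 H2|i _].
  exact: ordgeM.
by rewrite -[X in ordge _ X]mul1n; apply: ordgeX.
Qed.

Lemma ordge_msubst n n' (h : 'I_n -> {mpoly R[n']}) (p : {mpoly R[n]}) m :
  (forall i, ordge (h i) 1) -> ordge p m -> ordge (msubst h p) m.
Proof.
move=> hh hp; rewrite /msubst /mmap; apply: ordge_sum => u su _.
apply: ordgeMl; apply: (ordgeW _ (ordge_mmap1 (u := u) hh)).
by rewrite leqNgt; apply: contraTN su => /hp; rewrite mcoeff_msupp => ->; rewrite eqxx.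
Qed.

(* For a homogeneous [p] this is the multiplicity at a representative [a] in the
   affine cone, which is all that the lower bounds need of [p \in P^m]. *)
Definition vanish n (p : {mpoly R[n]}) (a : 'I_n -> R) (m : nat) :=
  ordge (msubst (fun i => 'X_i + (a i)%:MP) p) m.

Lemma vanishW n (p : {mpoly R[n]}) a m m' :
  (m' <= m)%N -> vanish p a m -> vanish p a m'.
Proof. exact: ordgeW. Qed.

Lemma vanish_sum n (I : eqType) (r : seq I) (P : pred I) (F : I -> {mpoly R[n]}) a m :
  (forall i, i \in r -> P i -> vanish (F i) a m) ->
  vanish (\sum_(i <- r | P i) F i) a m.
Proof. by move=> hF; rewrite /vanish rmorph_sum; apply: ordge_sum. Qed.

Lemma vanishM n (p q : {mpoly R[n]}) a m m' :
  vanish p a m -> vanish q a m' -> vanish (p * q) a (m + m').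
Proof. by move=> hp hq; rewrite /vanish rmorphM; apply: ordgeM. Qed.

Lemma vanishMl n (p q : {mpoly R[n]}) a m : vanish p a m -> vanish (q * p) a m.
Proof. by move=> hp; rewrite /vanish rmorphM; apply: ordgeMl. Qed.

Lemma vanishX n (p : {mpoly R[n]}) a m j :
  vanish p a m -> vanish (p ^+ j) a (m * j).
Proof. by move=> hp; rewrite /vanish rmorphXn; apply: ordgeX. Qed.

Lemma ordge1P n (p : {mpoly R[n]}) : p@_0%MM = 0 -> ordge p 1.
Proof. by move=> p0 u; rewrite ltnS leqn0 mdeg_eq0 => /eqP->. Qed.

Lemma mcoeff0_translate n (p : {mpoly R[n]}) (a : 'I_n -> R) :
  (msubst (fun i => 'X_i + (a i)%:MP) p)@_0%MM = p.@[a].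
Proof.
rewrite /msubst (rmorph_mmap (mcoeff 0%MM)) /meval; apply: eq_mmap => [c|i] /=.
  by rewrite mcoeffC eqxx mulr1.
by rewrite mcoeffD mcoeffX mcoeffC eqxx mulr1 mnm1_eq0 add0r.
Qed.

Lemma vanish1P n (p : {mpoly R[n]}) a : p.@[a] = 0 -> vanish p a 1.
Proof. by move=> pa0; apply: ordge1P; rewrite mcoeff0_translate. Qed.

(** Once both points are moved to the origin, the substituted polynomials have no constant term, so
    the order cannot drop. *)
Lemma vanish_msubst n n' (h : 'I_n -> {mpoly R[n']}) p a b m :
  (forall i, (h i).@[b] = a i) -> vanish p a m -> vanish (msubst h p) b m.
Proof.
move=> hb hp; rewrite /vanish msubst_comp.
pose h' i := msubst (fun i => 'X_i + (b i)%:MP) (h i) - (a i)%:MP.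
have -> : msubst (fun i => msubst (fun i => 'X_i + (b i)%:MP) (h i)) p
        = msubst h' (msubst (fun i => 'X_i + (a i)%:MP) p).
  rewrite msubst_comp; apply: eq_msubst => i.
  by rewrite rmorphD /= msubstXU msubstC /h' subrK.
apply: ordge_msubst hp => i; apply: ordge1P.
by rewrite mcoeffB mcoeff0_translate hb mcoeffC eqxx mulr1 subrr.
Qed.

(** Taylor expansion at [a], obtained by translating to the origin and back. *)
Lemma vanish_expand n (p : {mpoly R[n]}) a m : vanish p a m ->
  exists g : {mpoly R[n]}, ordge g m /\
    p = \sum_(u <- msupp g) g@_u *: \prod_i ('X_i - (a i)%:MP) ^+ u i.
Proof.
move=> hp; exists (msubst (fun i => 'X_i + (a i)%:MP) p); split=> //.
set g := msubst _ _.
have -> : p = msubst (fun i => 'X_i - (a i)%:MP) g.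
  rewrite msubst_comp -[LHS]msubst_id; apply: eq_msubst => i.
  by rewrite rmorphD /= msubstXU msubstC subrK.
by rewrite /msubst /mmap; apply: eq_bigr => u _; rewrite mul_mpolyC.
Qed.

End Order.

Lemma map_msubst (R S : comNzRingType) (phi : {rmorphism R -> S}) n n'
   (h : 'I_n -> {mpoly R[n']}) (p : {mpoly R[n]}) :
  map_mpoly phi (msubst h p) = msubst (map_mpoly phi \o h) (map_mpoly phi p).
Proof.
rewrite /map_mpoly {2}/msubst rmorph_mmap /=.
rewrite /msubst rmorph_mmap /=; apply: eq_mmap => [c|i] /=.
  by rewrite !mmapC.
by rewrite mmapX mmap1U.
Qed.

Lemma map_translate (R S : comNzRingType) (phi : {rmorphism R -> S}) n
   (a : 'I_n -> R) (p : {mpoly R[n]}) :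
  map_mpoly phi (msubst (fun i => 'X_i + (a i)%:MP) p)
  = msubst (fun i => 'X_i + (phi (a i))%:MP) (map_mpoly phi p).
Proof.
rewrite map_msubst; apply: eq_msubst => i /=.
by rewrite rmorphD /= map_mpolyX map_mpolyC.
Qed.

Section OrderDomain.
Variables (R : idomainType) (n : nat).
Implicit Types p q : {mpoly R[n]}.

(** The monomial order is compatible with addition, so no other pair of monomials contributes to
    this exponent. *)
Lemma mcoeffM_mlast p q :
  (p * q)@_(mlast p + mlast q) = p@_(mlast p) * q@_(mlast q).
Proof.
have [->|nz_p] := eqVneq p 0; first by rewrite mul0r !mcoeff0 mul0r.
have [->|nz_q] := eqVneq q 0; first by rewrite mulr0 !mcoeff0 mulr0.
rewrite mpolyME (bigD1_seq (mlast p, mlast q)) /=; first last.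
- by rewrite allpairs_uniq => // -[? ?] [].
- by rewrite allpairs_f// !mlast_supp.
rewrite mcoeffD mcoeffZ mcoeffX eqxx mulr1.
rewrite big_seq_cond raddf_sum /= big1 ?addr0 // => uv.
case/andP=> [/allpairsP[[u v] [/= su sv ->]]] /= ne.
have le_u := mlast_lemc su; have le_v := mlast_lemc sv.
rewrite mcoeffZ mcoeffX; case: eqP => [E|_]; last by rewrite mulr0.
case/negP: ne; rewrite xpair_eqE.
move: le_u; rewrite le_eqVlt => /predU1P[Eu|lt_u].
  by move: E; rewrite Eu => /addmI->; rewrite !eqxx.
by have := ltmc_le_add lt_u le_v; rewrite -E ltxx.
Qed.

(** The monomial order refines the degree, so [mlast] sits in lowest degree. Over a domain lowest
    degrees add up, and the coefficient at [u] caps that of [q] at [mdeg u]. *)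
Lemma ordge_divr p q u m :
  q@_u != 0 -> ordge (p * q) m -> ordge p (m - mdeg u).
Proof.
move=> qu hpq v lt_v; apply/eqP; apply: contraTT lt_v => pv; rewrite -leqNgt.
have lep : (mdeg (mlast p) <= mdeg v)%N.
  by apply: lemc_mdeg; apply: mlast_lemc; rewrite mcoeff_msupp.
have leq : (mdeg (mlast q) <= mdeg u)%N.
  by apply: lemc_mdeg; apply: mlast_lemc; rewrite mcoeff_msupp.
have p0 : p != 0 by apply: contraNneq pv => ->; rewrite mcoeff0.
have q0 : q != 0 by apply: contraNneq qu => ->; rewrite mcoeff0.
have : (p * q)@_(mlast p + mlast q) != 0.
  by rewrite mcoeffM_mlast mulf_neq0 // -mcoeff_msupp mlast_supp.
have [/hpq->|] := ltnP (mdeg (mlast p + mlast q)%MM) m; first by rewrite eqxx.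
rewrite mdegD; lia.
Qed.

End OrderDomain.

(** Lowest and highest degrees both add up in a product. Both sums are [D] and [q] contributes [e]
    to each, so [p] lives in degree [D - e] alone. *)
Lemma dhomog_divr (R : idomainType) n (p q : {mpoly R[n]}) D e :
    p * q != 0 -> p * q \is D.-homog -> q \is e.-homog ->
  (e <= D)%N /\ p \is (D - e).-homog.
Proof.
move=> nz hpq hq.
have /andP[p0 q0] : (p != 0) && (q != 0) by rewrite -negb_or -mulf_eq0.
have hmin : (mdeg (mlast p) + mdeg (mlast q))%N = D.
  rewrite -mdegD; apply: (dhomog_mf hpq); rewrite mcoeff_msupp mcoeffM_mlast.
  by rewrite mulf_neq0 // -mcoeff_msupp mlast_supp.
have hmax : (mdeg (mlead p) + mdeg (mlead q))%N = D.
  by rewrite -mdegD -mleadM //; apply: (dhomog_mf hpq); apply: mlead_supp.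
have hq1 : mdeg (mlast q) = e := dhomog_mf hq (mlast_supp q0).
have hq2 : mdeg (mlead q) = e := dhomog_mf hq (mlead_supp q0).
split; first lia.
apply/dhomogP => u su /=.
have := lemc_mdeg (mlast_lemc su); have := lemc_mdeg (msupp_le_mlead su); lia.
Qed.

(** * Star configurations *)

Section Star.
Variable k : fieldType.

(* Points of projective [r]-space are polynomials of degree at most [r], the
   hyperplane of a node [t] consists of those vanishing at [t], and so
   [\prod_(t <- S) ('X - t)] is the common point of the hyperplanes of [S].
   The hyperplane of [t] is parametrized by [Q |-> ('X - t) * Q], which maps
   star configurations to star configurations. *)
Definition star_pt r (S : seq k) (j : 'I_r.+1) : k :=
  (\prod_(t <- S) ('X - t%:P))`_j.

Definition node_form r (t : k) : {mpoly k[r.+1]} := \sum_(j < r.+1) t ^+ j *: 'X_j.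

Definition node_param r (t : k) (j : 'I_r.+2) : {mpoly k[r.+1]} :=
  \sum_(i < r.+1) (('X - t%:P) * 'X^i)`_j *: 'X_i.

Lemma node_param_homog r t j : @node_param r t j \is 1.-homog.
Proof. by apply: rpred_sum => i _; apply: rpredZ; rewrite dhomogX /= mdeg1. Qed.

Lemma node_form_homog r t : node_form r t \is 1.-homog.
Proof. by apply: rpred_sum => i _; apply: rpredZ; rewrite dhomogX /= mdeg1. Qed.

Lemma meval_node_form r t (a : 'I_r.+1 -> k) :
  (node_form r t).@[a] = \sum_(j < r.+1) t ^+ j * a j.
Proof.
by rewrite raddf_sum; apply: eq_bigr => j _; rewrite /= mevalZ mevalXU.
Qed.

Lemma node_form_star r t S : size S = r ->
  (node_form r t).@[star_pt S] = \prod_(s <- S) (t - s).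
Proof.
move=> szS; rewrite meval_node_form.
have szP : size (\prod_(s <- S) ('X - s%:P)) = r.+1 by rewrite size_prod_XsubC szS.
have -> : \prod_(s <- S) (t - s) = (\prod_(s <- S) ('X - s%:P)).[t].
  by rewrite horner_prod; apply: eq_bigr => s _; rewrite hornerXsubC.
by rewrite horner_coef szP; apply: eq_bigr => j _; rewrite mulrC.
Qed.

Lemma coef_mul_XsubC_expand (A : comNzRingType) (f : {rmorphism k -> A}) r (t : k)
    (Q : {poly A}) (j : nat) : (size Q <= r.+1)%N ->
  \sum_(i < r.+1) f ((('X - t%:P) * 'X^i)`_j) * Q`_i = (('X - (f t)%:P) * Q)`_j.
Proof.
move=> szQ.
have -> : Q = \sum_(i < r.+1) Q`_i *: 'X^i.
  rewrite -poly_def; apply/polyP => i; rewrite coef_poly; case: ltnP => // le_i.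
  by rewrite nth_default // (leq_trans szQ).
rewrite mulr_sumr coef_sum; apply: eq_bigr => i _.
rewrite -scalerAr coefZ -coef_map /= rmorphM /= map_polyXn map_polyXsubC mulrC.
by congr (_ * _); rewrite -poly_def coef_poly ltn_ord.
Qed.

Lemma meval_node_param r t (S : seq k) j : size S = r ->
  (@node_param r t j).@[star_pt S] = star_pt (t :: S) j.
Proof.
move=> szS; rewrite /star_pt big_cons.
rewrite -[t in RHS]/(idfun t) -(@coef_mul_XsubC_expand _ idfun r)
    ?size_prod_XsubC ?szS //.
by rewrite raddf_sum; apply: eq_bigr => i _; rewrite /= mevalZ mevalXU.
Qed.

(* Dividing the generic polynomial [\sum_j X_j T^j] by [T - t] leaves the
   remainder [node_form t], and the quotient inverts [node_param t]. *)
Lemma node_form_dvd r t (F : {mpoly k[r.+2]}) :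
  msubst (@node_param r t) F = 0 -> exists G, F = G * node_form r.+1 t.
Proof.
move=> F0; set l := node_form _ _.
pose P : {poly {mpoly k[r.+2]}} := \poly_(j < r.+2) 'X_(inord j).
have Pj (j : 'I_r.+2) : P`_j = 'X_j by rewrite coef_poly ltn_ord inord_val.
have Pt : P.[t%:MP] = l.
  rewrite horner_poly /l /node_form; apply: eq_bigr => j _.
  by rewrite inord_val mulrC -rmorphXn /= mul_mpolyC.
have /factor_theorem[Q EQ] : root (P - l%:P) t%:MP.
  by rewrite rootE hornerD hornerN hornerC Pt subrr.
have szQ : (size Q <= r.+1)%N.
  have [->|Q0] := eqVneq Q 0; first by rewrite size_poly0.
  have := size_Mmonic Q0 (monicXsubC (t%:MP : {mpoly k[r.+2]})).
  rewrite size_XsubC addn2 /= -ltnS => <-; rewrite -EQ.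
  apply: leq_trans (size_polyD _ _) _; rewrite size_polyN geq_max size_poly.
  exact: leq_trans (size_polyC_leq1 _) _.
pose psi (i : 'I_r.+1) : {mpoly k[r.+2]} := Q`_i.
have [i|q Eq] := @msubst_congr k _ _ l (fun i => 'X_i)
    (fun i => msubst psi (@node_param r t i)) F.
  (* As [P = Q * (T - t) + l], the difference is [l] in coordinate 0 and zero in the others. *)
  exists (i == 0%N :> nat)%:R.
  have -> : msubst psi (node_param t i) = (Q * ('X - (t%:MP)%:P))`_i.
    rewrite mulrC -(@coef_mul_XsubC_expand _ (@mpolyC r.+2 k) r) //.
    rewrite rmorph_sum; apply: eq_bigr => j _.
    by rewrite /= msubstZ msubstXU mul_mpolyC.
  rewrite -EQ coefB coefC Pj opprB addrC subrK.
  by case: eqP => _; rewrite ?mulr1 ?mulr0.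
by exists q; rewrite mulrC -Eq msubst_id -msubst_comp F0 rmorph0 subr0.
Qed.

Lemma translate_node_form r t (a : 'I_r.+1 -> k) :
  (msubst (fun i => 'X_i + (a i)%:MP) (node_form r t))@_U_(ord0) = 1.
Proof.
rewrite rmorph_sum raddf_sum /= big_ord_recl /=.
rewrite msubstZ msubstXU mcoeffZ mcoeffD mcoeffXU mcoeffC mnm1_eq0 eqxx.
rewrite mulr0 addr0 expr0 mulr1 big1 ?addr0 // => i _.
rewrite msubstZ msubstXU mcoeffZ mcoeffD mcoeffXU mcoeffC mnm1_eq0.
by rewrite mulr0 addr0 mulr0.
Qed.

(** The equation of a hyperplane has order at most 1 at every point, its coefficient at [X_0] being
    [t ^+ 0 = 1], and order 0 off the hyperplane. *)
Lemma vanish_node_form_div r t (S : seq k) (G : {mpoly k[r.+1]}) m :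
    size S = r -> vanish (G * node_form r t) (star_pt S) m ->
  vanish G (star_pt S) (m - (t \in S)).
Proof.
move=> szS; rewrite /vanish rmorphM /=.
have [tS|tS] := boolP (t \in S).
  have -> : nat_of_bool true = mdeg (U_(ord0 : 'I_r.+1))%MM by rewrite mdeg1.
  move=> /ordge_divr; apply.
  by rewrite translate_node_form oner_neq0.
have -> : nat_of_bool false = mdeg (0 : 'X_{1..r.+1})%MM by rewrite mdeg0.
move=> /ordge_divr; apply.
rewrite mcoeff0_translate node_form_star // prodf_seq_neq0.
by apply/allP => s sS /=; rewrite subr_eq0; apply: contraNneq tS => ->.
Qed.

(** A form in one variable is a multiple of [X ^+ D], and the single coordinate of [star_pt [::]] is
    1. This starts the induction on the dimension. *)
Lemma vanish_one_variable D m (F : {mpoly k[1]}) :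
  F != 0 -> F \is D.-homog -> vanish F (star_pt [::]) m -> m = 0%N.
Proof.
move=> F0 hF vF; apply/eqP; rewrite -leqn0 leqNgt; apply: contraNN F0 => m_gt0.
have uniqm (u : 'X_{1..1}) : mdeg u = D -> u = (U_(ord0) *+ D)%MM.
  rewrite mdegE big_ord1 => Eu; apply/mnmP => i.
  by rewrite ord1 mulmnE mnm1E eqxx mul1n.
have EF : F = F@_(U_(ord0) *+ D)%MM *: 'X_[U_(ord0) *+ D].
  apply/mpolyP => u; rewrite mcoeffZ mcoeffX.
  case: eqP => [->|ne]; first by rewrite mulr1.
  rewrite mulr0 (dhomog_nemf_coeff hF) //; apply: contra_notN ne => /eqP Eu.
  by rewrite [RHS]uniqm.
have := vF 0%MM; rewrite mdeg0 => /(_ m_gt0).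
rewrite mcoeff0_translate EF mevalZ mevalX big_ord1 /star_pt big_nil coef1 /=.
by rewrite expr1n mulr1 => ->; rewrite scale0r.
Qed.

(* The weights [c] record the powers of the [node_form]s already divided out. *)
Lemma star_bound r D (ts : seq k) (c : k -> nat) m (F : {mpoly k[r.+1]}) :
    uniq ts -> (r <= size ts)%N -> F != 0 -> F \is D.-homog ->
    (forall S, uniq S -> size S = r -> {subset S <= ts} ->
       vanish F (star_pt S) (m - \sum_(t <- S) c t)) ->
  if r == 0%N then m = 0%N
  else (size ts * m <= r * (D + \sum_(t <- ts) c t))%N.
Proof.
elim: r D ts c m F => [|r IHr] D ts c m F.
  move=> _ _ F0 hF vF.
  have {}vF : vanish F (star_pt [::]) m.
    by have := vF [::]; rewrite big_nil subn0; apply.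
  exact: (vanish_one_variable F0 hF vF).
have [d] := ubnP D; elim: d D c F => // d IHd D c F le_D uts szts F0 hF vF /=.
(* Either [F] vanishes on the hyperplane of some node, whose equation then divides [F], or [F]
   restricts to a nonzero form on each of them. *)
have [/hasP[t tts /eqP Ft0]|/hasPn nz] :=
    boolP (has (fun t => msubst (@node_param r t) F == 0) ts).
  have [G EF] := node_form_dvd Ft0; rewrite EF in F0 hF vF.
  have [D_gt0 hG] := dhomog_divr F0 hF (node_form_homog r.+1 t).
  have G0 : G != 0 by apply: contraNneq F0 => ->; rewrite mul0r.
  (* Division lowers the degree by one and raises the weight of [t] by one, so the bound to be
     proved stays the same. *)
  pose c' s := (c s + (s == t))%N.
  have sumc' S : uniq S -> (\sum_(s <- S) c' s = \sum_(s <- S) c s + (t \in S))%N.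
    by move=> uS; rewrite big_split /= -big_mkcond /= sum1_count count_uniq_mem.
  have lt_D : (D - 1 < d)%N by lia.
  have vG S : uniq S -> size S = r.+1 -> {subset S <= ts} ->
      vanish G (star_pt S) (m - \sum_(s <- S) c' s).
    move=> uS szS sS; rewrite sumc' // subnDA; apply: vanish_node_form_div => //.
    exact: vF.
  have := IHd (D - 1)%N c' G lt_D uts szts G0 hG vG.
  rewrite /= sumc' // tts; congr (_ <= _ * _)%N.
  by rewrite addn1 addnS -addSn subn1 prednK.
(* Restricting to a node of least weight gives [size ts * c t <= \sum c], which alone settles the
   claim when [m] is at most the dimension times [c t]. *)
have [t tts tmin] : exists2 t, t \in ts & forall s, s \in ts -> (c t <= c s)%N.
  have [t0 t0ts] : exists t0, t0 \in ts.
    by case: (ts) szts => // t0 ts' _; exists t0; rewrite mem_head.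
  have ex : exists n, [pred n | has (fun t => c t == n) ts] n.
    by exists (c t0); apply/hasP; exists t0.
  case: (ex_minnP ex) => n /hasP[t tts /eqP <-] min; exists t => // s sts.
  by apply: min; apply/hasP; exists s.
have le_sum : (size ts * c t <= \sum_(s <- ts) c s)%N.
  have : {in ts, forall s, c t <= c s}%N by [].
  elim: (ts) => [|s l IHl] H; first by rewrite big_nil.
  rewrite big_cons mulSn leq_add ?IHl ?H ?mem_head // => x xl.
  by apply: H; rewrite inE xl orbT.
have Esum : (\sum_(s <- ts) c s = c t + \sum_(s <- rem t ts) c s)%N.
  by rewrite (perm_big _ (perm_to_rem tts)) big_cons.
have szrem : size (rem t ts) = (size ts).-1 by apply: size_rem.
have G0 := nz t tts; have hG := dhomog_msubst (node_param_homog t) hF.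
have vG S : uniq S -> size S = r -> {subset S <= rem t ts} ->
    vanish (msubst (@node_param r t) F) (star_pt S) (m - c t - \sum_(s <- S) c s).
  move=> uS szS sS; have : vanish F (star_pt (t :: S)) (m - \sum_(s <- t :: S) c s).
    apply: vF.
    - rewrite /= uS andbT; apply/negP => /sS; rewrite mem_rem_uniq // inE.
      by rewrite eqxx.
    - by rewrite /= szS.
    - by move=> s; rewrite inE => /predU1P[->//|/sS /mem_rem].
  rewrite big_cons subnDA; apply: vanish_msubst => j.
  by rewrite meval_node_param.
have le_r : (r <= size (rem t ts))%N by rewrite szrem; lia.
have := IHr D (rem t ts) c (m - c t)%N _ (rem_uniq t uts) le_r G0 hG vG.
rewrite Esum in le_sum *.
move: (\sum_(s <- rem t ts) c s)%N le_sum => X le_sum.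
rewrite szrem; move: szts le_sum; clear.
move: (size ts) (c t) => n x; case: r => [|r] /= szts le_sum.
  by move=> m0; nia.
move=> H; have [le_m|/ltnW/subnKC Em] := leqP m (r.+2 * x).
  by nia.
(* Multiplied by [r.+1], the claim follows from [r.+2] times the induction hypothesis. With
   [n = r.+2 + e] and [m = r.+2 * x + f], the slack in the first step is [e * f]. *)
have E : (r.+1 * (n * m) <= r.+1 * (r.+2 * (D + (x + X))))%N.
  apply: (@leq_trans (r.+1 * r.+2 * x + r.+2 * (n.-1 * (m - x)))); last by nia.
  rewrite -(subnKC szts) -Em; move: (n - _)%N (m - _)%N => e f.
  by rewrite (_ : _ - x = r.+1 * x + f)%N; nia.
by rewrite leq_pmul2l in E.
Qed.



End Star.

(** * Specialization to large positive characteristic *)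

Lemma ex_min_nat (P : nat -> Prop) :
  (exists n, P n) -> exists n, P n /\ forall m, P m -> (n <= m)%N.
Proof.
case=> n; elim/ltn_ind: n => n IHn Pn.
have [[m [lt_mn Pm]]|nex] := classic (exists m, (m < n)%N /\ P m).
  exact: IHn Pm.
exists n; split=> // m Pm; rewrite leqNgt; apply/negP => lt_mn.
by apply: nex; exists m.
Qed.

Section Specialization.
Variable k : fieldType.

(** The image of [alpha] is a subring of [k] presented by [A], with [ker alpha] as relations. Since
    [beta] kills these, it is a reduction of the subring itself, and it keeps a prescribed element
    nonzero. *)
Definition specializable (A : comNzRingType) (alpha : {rmorphism A -> k}) :=
  forall (u : A) (B : nat), alpha u != 0 ->
  exists (F : closedFieldType) (p : nat) (beta : {rmorphism A -> F}),
    [/\ p \in [pchar F], (B < p)%N, beta u != 0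
      & forall x, alpha x = 0 -> beta x = 0].

(** In characteristic 0 [alpha] is injective, and a prime beyond the absolute value of [u] does not
    divide [u]. *)
Lemma specializable_int (alpha : {rmorphism int -> k}) :
  [pchar k] =i pred0 -> specializable alpha.
Proof.
move=> /pcharf0P k0 u B au.
have alphaE x : alpha x = x%:~R by rewrite -[x in LHS]intz rmorph_int.
have inj x : alpha x = 0 -> x = 0.
  rewrite alphaE => /eqP; case: (intP x) => [|n|n] //.
    by rewrite -pmulrn k0.
  by rewrite mulrNz oppr_eq0 -pmulrn k0.
have [p lt_p pr_p] := prime_above (maxn B `|u|%N).
have [F [/= inF _]] := countable_algebraic_closure 'F_p.
have chF : p \in [pchar F] by rewrite (fmorph_pchar inF) pchar_Fp.
exists F, p, intr; split => //; first 1 last.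
- move: lt_p; rewrite gtn_max => /andP[_ lt_u].
  have u0 : u != 0 by apply: contraNneq au => ->; rewrite rmorph0.
  have : (`|u|%N)%:R != 0 :> F.
    rewrite -(dvdn_pcharf chF); apply/negP => /dvdn_leq.
    by rewrite absz_gt0 u0 => /(_ isT); rewrite leqNgt lt_u.
  apply: contraNneq => /(congr1 (fun x => x * ((sgz u)%:~R))).
  by rewrite mul0r -intrM mulrC -abszEsg -pmulrn => ->.
- by move=> x /inj->.
- by move: lt_p; rewrite gtn_max => /andP[].
Qed.

Section PolyStep.
Variables (A : comNzRingType) (alpha : {rmorphism A -> k}) (c : k).
Hypothesis specA : specializable alpha.

Local Notation "f ^a" := (map_poly alpha f) (at level 2, format "f ^a").
Local Notation ev f := (f^a).[c].

(** [alpha] may kill leading coefficients; truncation makes the leading one survive, so that its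
    powers can be cancelled after pseudo-division. *)
Lemma map_poly_truncate (f : {poly A}) : exists g : {poly A},
  [/\ g^a = f^a, (size g <= size f)%N & size g = size g^a].
Proof.
have Eg : (\poly_(i < size f^a) f`_i)^a = f^a.
  apply/polyP => i; rewrite !coef_map /= coef_poly; case: ltnP => // le_i.
  by rewrite rmorph0 -coef_map [RHS]nth_default.
exists (\poly_(i < size f^a) f`_i); split => //.
  exact: leq_trans (size_poly _ _) (size_poly _ _).
apply/eqP; rewrite eqn_leq {1}Eg size_poly /=.
exact: size_poly.
Qed.

Lemma map_lead_coef_neq0 (g : {poly A}) :
  g^a != 0 -> size g = size g^a -> alpha (lead_coef g) != 0.
Proof. by move=> g0 sz; rewrite /lead_coef -coef_map sz -/(lead_coef _) lead_coef_eq0. Qed.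

Lemma pseudo_division (f g : {poly A}) : g != 0 -> exists e (Q R : {poly A}),
  [/\ (lead_coef g ^+ e)%:P * f = Q * g + R & (size R < size g)%N].
Proof.
move=> g0; exists (Pdiv.Ring.rscalp f g), (Pdiv.Ring.rdivp f g), (Pdiv.Ring.rmodp f g).
split; last by rewrite Pdiv.Ring.ltn_rmodp.
by rewrite mul_polyC Pdiv.ComRing.rdivp_eq.
Qed.

Lemma evM f g : ev (f * g) = ev f * ev g.
Proof. by rewrite rmorphM hornerM. Qed.
Lemma evD f g : ev (f + g) = ev f + ev g.
Proof. by rewrite rmorphD hornerD. Qed.
Lemma evC x : ev x%:P = alpha x.
Proof. by rewrite map_polyC hornerC. Qed.

Section Algebraic.
Variable h : {poly A}.
Hypotheses (h_neq0 : h^a != 0) (evh : ev h = 0) (szh : size h = size h^a).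
Hypothesis minh : forall g : {poly A}, g^a != 0 -> ev g = 0 -> (size h^a <= size g^a)%N.

Lemma minimal_eq0 (g : {poly A}) : ev g = 0 -> (size g < size h)%N -> g^a = 0.
Proof.
move=> evg lt_g; apply: contraTeq lt_g => g0; rewrite -leqNgt szh.
by apply: leq_trans (minh g0 evg) _; apply: size_poly.
Qed.

(* Euclid's algorithm: modulo the minimal relation [h] of [c], an element that is
   nonzero at [c] divides a nonzero constant. *)
Lemma ev_inv_small (u : {poly A}) : (size u < size h)%N -> ev u != 0 ->
  exists (v : {poly A}) n0, alpha n0 != 0 /\ ev (v * u) = alpha n0.
Proof.
have [n] := ubnP (size u); elim: n u => // n IHn u lt_n lt_u evu.
have [g [Eg le_g szg]] := map_poly_truncate u.
have g0 : g^a != 0 by apply: contraNneq evu; rewrite -Eg => ->; rewrite horner0.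
have lg := map_lead_coef_neq0 g0 szg.
have [/size1_polyC gC|g_gt1] := leqP (size g) 1.
  have evg : ev u = alpha g`_0 by rewrite -Eg {1}gC evC.
  by exists 1, g`_0; rewrite mul1r evg -evg.
have g_neq0 : g != 0 by rewrite -size_poly_gt0 ltnW.
have [e [Q [R [E lt_R]]]] := pseudo_division h g_neq0.
have evE : ev Q * ev u + ev R = 0.
  by rewrite -Eg -evM -evD -E evM evh mulr0.
have [evR|evR] := eqVneq (ev R) 0; last first.
  have [lt1 lt2] : (size R < n)%N /\ (size R < size h)%N by lia.
  have [v [n0 [n00 Ev]]] := IHn R lt1 lt2 evR.
  exists (- (v * Q)), n0; split => //; rewrite -Ev mulNr -mulrA rmorphN hornerN !evM.
  by rewrite -mulrN; congr (_ * _); apply/eqP; rewrite eq_sym -addr_eq0 addrC evE.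
(* By minimality [R] is then zero over [k], and [Q * g] is a constant multiple of [h]. As [Q]
   vanishes at [c] and [g] is not constant, [Q] has too small a degree. *)
have R0 : R^a = 0 by apply: minimal_eq0 => //; lia.
have evQ : ev Q = 0.
  by move/eqP: evE; rewrite evR addr0 mulf_eq0 (negbTE evu) orbF => /eqP.
have EQ : (alpha (lead_coef g ^+ e))%:P * h^a = Q^a * g^a.
  by rewrite -map_polyC -rmorphM /= E rmorphD /= R0 addr0 rmorphM.
have le0 : alpha (lead_coef g ^+ e) != 0 by rewrite rmorphXn expf_neq0.
have Q0 : Q^a != 0.
  apply: contraNneq h_neq0 => Q0; move/eqP: EQ; rewrite Q0 mul0r mulf_eq0.
  by rewrite polyC_eq0 (negbTE le0).
have := minh Q0 evQ; have := congr1 (fun p : {poly k} => size p) EQ.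
rewrite mul_polyC size_scale // size_mul // => ->; rewrite -szg.
by move: g_gt1; case: (size g) => [|[|l]] // _; rewrite addnS /= addnS ltnNge leq_addr.
Qed.

Lemma ev_inv (u : {poly A}) : ev u != 0 ->
  exists (v : {poly A}) n0, alpha n0 != 0 /\ ev (v * u) = alpha n0.
Proof.
move=> evu; have lh := map_lead_coef_neq0 h_neq0 szh.
have h0 : h != 0 by apply: contraNneq h_neq0 => ->; rewrite rmorph0.
have [e [Q [R [E lt_R]]]] := pseudo_division u h0.
have ER : ev R = ev ((lead_coef h ^+ e)%:P * u) by rewrite E evD evM evh mulr0 add0r.
have evR : ev R != 0 by rewrite ER evM evC rmorphXn mulf_neq0 // expf_neq0.
have [v [n0 [n00 Ev]]] := ev_inv_small lt_R evR.
by exists (v * (lead_coef h ^+ e)%:P), n0; rewrite -mulrA evM -ER -evM.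
Qed.

(** Let [lead_coef h] and [n0] survive and send the variable to a root of the image of [h].
    Pseudo-division by [h] shows that all relations of [c] are respected, and [u] survives because
    it divides [n0] modulo them. *)
Lemma specializable_algebraic : specializable (horner_eval c \o map_poly alpha).
Proof.
move=> u B /= evu; have [v [n0 [n00 Ev]]] := ev_inv evu.
have lh := map_lead_coef_neq0 h_neq0 szh.
have h0 : h != 0 by apply: contraNneq h_neq0 => ->; rewrite rmorph0.
have [|F [p [beta [chF ltB bu kerb]]]] := specA (u := lead_coef h * n0) B.
  by rewrite rmorphM mulf_neq0.
move: bu; rewrite rmorphM mulf_eq0 negb_or => /andP[bl bn0].
have szb : size (map_poly beta h) = size h by apply: size_map_poly_id0.
have [x /rootP hx] : exists x, root (map_poly beta h) x.
  apply/closed_rootP; rewrite szb szh; apply/negP => /eqP sz1.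
  have := evh; rewrite (size1_polyC (eq_leq sz1)) hornerC => E0.
  by move: h_neq0; rewrite (size1_polyC (eq_leq sz1)) E0 eqxx.
have ker w : ev w = 0 -> (map_poly beta w).[x] = 0.
  move=> evw; have [e [Q [R [E lt_R]]]] := pseudo_division w h0.
  have evR : ev R = 0.
    by move: (congr1 (fun f => ev f) E); rewrite evD !evM evw evh !mulr0 add0r.
  have Ra := minimal_eq0 evR lt_R.
  have Rb : map_poly beta R = 0.
    apply/polyP => i; rewrite coef_map coef0; apply: kerb.
    by rewrite -coef_map Ra coef0.
  have := congr1 (fun f => (map_poly beta f).[x]) E.
  rewrite rmorphD /= Rb addr0 !rmorphM !hornerM hx mulr0 /= map_polyC hornerC /= => /eqP.
  by rewrite mulf_eq0 rmorphXn expf_eq0 (negbTE bl) andbF => /eqP.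
exists F, p, (horner_eval x \o map_poly beta); split=> //=; rewrite /horner_eval.
have : ev (v * u - n0%:P) = 0 by rewrite rmorphB hornerD hornerN Ev evC subrr.
move=> /ker; rewrite rmorphB hornerD hornerN /= map_polyC hornerC rmorphM hornerM.
move/eqP; rewrite subr_eq0 => /eqP /= E.
by apply: contraNneq bn0 => E0; rewrite -E E0 mulr0.
Qed.

End Algebraic.

Lemma specializable_poly : specializable (horner_eval c \o map_poly alpha).
Proof.
have [[h [h0 evh]]|trans] := classic (exists h : {poly A}, h^a != 0 /\ ev h = 0).
  have [|n [[h1 [h10 evh1 sz1]] minn]] := @ex_min_nat
     (fun n => exists h : {poly A}, [/\ h^a != 0, ev h = 0 & size h^a = n]).
    by exists (size h^a), h.
  have [g [Eg _ szg]] := map_poly_truncate h1.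
  apply: (@specializable_algebraic g); rewrite -?szg ?Eg // => f f0 evf.
  by rewrite szg Eg sz1; apply: minn; exists f.
(* For [c] transcendental, keep the coefficient of [u] that leads over [k], and send the variable to
   a non-root. *)
move=> u B /= evu.
have u0 : u^a != 0.
  by apply: contraNneq evu => u0; rewrite /horner_eval u0 horner0.
have := u0; rewrite -lead_coef_eq0 /lead_coef coef_map => /(specA B).
move=> [F [p [beta [chF ltB bu kerb]]]].
have /closed_nonrootP[x nx] : map_poly beta u != 0.
  apply: contraNneq bu => bu0.
  by rewrite -coef_map bu0 coef0.
exists F, p, (horner_eval x \o map_poly beta); split=> //= f evf.
rewrite /horner_eval; have fa : f^a = 0.
  by apply/eqP; apply: contra_notT trans => f0; exists f.
suff -> : map_poly beta f = 0 by rewrite horner0.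
apply/polyP => i; rewrite coef_map coef0; apply: kerb.
by rewrite -coef_map fa coef0.
Qed.

End PolyStep.

(** The elements of [cs] are adjoined to the integers one at a time, each by one more polynomial
    variable. *)
Lemma specializable_model (cs : seq k) : [pchar k] =i pred0 ->
  exists (A : comNzRingType) (alpha : {rmorphism A -> k}),
    specializable alpha /\ forall x, x \in cs -> exists y, alpha y = x.
Proof.
move=> k0; elim: cs => [|c cs [A [alpha [specA cov]]]].
  by exists int, intr; split=> //; apply: specializable_int.
exists {poly A}, (horner_eval c \o map_poly alpha); split.
  exact: specializable_poly.
move=> x; rewrite inE => /predU1P[->|/cov[y <-]].
  by exists 'X; rewrite /= /horner_eval map_polyX hornerX.
by exists y%:P; rewrite /= /horner_eval map_polyC hornerC.
Qed.

End Specialization.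

(** * Frobenius descent *)

Lemma mcoeffXM (R : comNzRingType) n (v w : 'X_{1..n}) (f : {mpoly R[n]}) :
  ('X_[v] * f)@_w = if (v <= w)%MM then f@_(w - v) else 0.
Proof.
rewrite mulrC; case: ifPn => [le_vw|nle].
  by rewrite -{1}(submK le_vw) addmC mcoeffMX.
apply/eqP; rewrite mcoeff_eq0; apply: contra nle.
by rewrite (perm_mem (msuppMX _ _)) => /mapP[u _ ->]; apply: lem_addr.
Qed.

Section Frobenius.
Variables (F : closedFieldType) (p : nat) (n : nat).
Hypothesis chF : p \in [pchar F].
Implicit Types (f g h : {mpoly F[n]}) (b : 'X_{1..n}).

Let p_gt0 : (0 < p)%N. Proof. exact: prime_gt0 (pcharf_prime chF). Qed.

Lemma pchar_mpoly : p \in [pchar {mpoly F[n]}].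
Proof. exact: (rmorph_pchar (@mpolyC n F)). Qed.

Lemma pth_root (c : F) : exists x, x ^+ p == c.
Proof.
have /closed_rootP[x] : size ('X^p - c%:P) != 1%N.
  by rewrite size_XnsubC // eqSS -lt0n.
by rewrite rootE !hornerE subr_eq0; exists x.
Qed.

Lemma pth_power_inj : injective (fun x : F => x ^+ p).
Proof. by move=> x y; rewrite -!(pFrobenius_autE chF) => /fmorph_inj. Qed.

(* [f = \sum_b (T_b f)^p X^b] over exponents [b < p], [F] being perfect;
   [cartier b f g] says [g = T_b f]. *)
Definition cartier (b : 'X_{1..n}) f g :=
  forall u : 'X_{1..n}, g@_u ^+ p = f@_(u *+ p + b).

Lemma cartier_exists b f : exists g, cartier b f g.
Proof.
pose root c := xchoose (pth_root c).
pose E (u : 'X_{1..n}) := root f@_(u *+ p + b).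
exists (\sum_(u : 'X_{1..n < msize f}) E u *: 'X_[u]) => u.
have [lt_u|le_u] := ltnP (mdeg u) (msize f).
  by rewrite mcoeff_mpoly //; apply/eqP/(xchooseP (pth_root _)).
rewrite raddf_sum big1 ?expr0n ?gtn_eqF //= => [|v _]; last first.
  rewrite mcoeffZ mcoeffX; case: eqP => [Ev|_]; last by rewrite mulr0.
  by have := bmdeg v; rewrite Ev ltnNge le_u.
apply/esym/memN_msupp_eq0/msize_mdeg_ge/(leq_trans le_u).
by rewrite mdegD mdegMn; nia.
Qed.

Lemma cartier_unique b f g g' : cartier b f g -> cartier b f g' -> g = g'.
Proof. by move=> Hg Hg'; apply/mpolyP => u; apply: pth_power_inj; rewrite /= Hg Hg'. Qed.

Lemma cartier0 b : cartier b 0 0.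
Proof. by move=> u; rewrite !mcoeff0 expr0n gtn_eqF. Qed.

Lemma cartierD b f f' g g' :
  cartier b f g -> cartier b f' g' -> cartier b (f + f') (g + g').
Proof.
move=> Hf Hg u; rewrite !mcoeffD -Hf -Hg.
by rewrite -!(pFrobenius_autE chF) rmorphD.
Qed.

Lemma cartierZ b c f g : cartier b f g -> cartier b (c ^+ p *: f) (c *: g).
Proof. by move=> Hf u; rewrite !mcoeffZ exprMn Hf. Qed.

Lemma cartierXM b v f g : (forall i, b i < p)%N ->
  cartier b f g -> cartier b ('X_[v] ^+ p * f) ('X_[v] * g).
Proof.
move=> ltb Hf u; rewrite mpolyXn !mcoeffXM.
have -> : (v *+ p <= u *+ p + b)%MM = (v <= u)%MM.
  apply/mnm_lepP/mnm_lepP => le_vu i; have := le_vu i; have := ltb i;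
  by rewrite mnmDE !mulmnE; nia.
case: ifP => [/mnm_lepP le_vu|_]; last by rewrite expr0n gtn_eqF.
rewrite Hf; congr mcoeff; apply/mnmP => i; have := le_vu i.
by rewrite !(mnmDE, mulmnE, mnmBE); nia.
Qed.

(** [T_b] is linear over p-th powers: additivity of Frobenius reduces to a single term of [h], and
    [b < p] ensures that [X^(p v)] divides [X^(p u + b)] only if [v <= u]. *)
Lemma cartierM b h f g : (forall i, b i < p)%N ->
  cartier b f g -> cartier b (h ^+ p * f) (h * g).
Proof.
move=> ltb Hf; elim/mpolyind: h => [|c v h _ _ IHh].
  by rewrite expr0n gtn_eqF // !mul0r; apply: cartier0.
rewrite -(pFrobenius_autE pchar_mpoly) rmorphD /= !pFrobenius_autE !mulrDl.
apply: cartierD IHh; rewrite exprZn -!scalerAl; apply: cartierZ.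
exact: cartierXM.
Qed.

(** Each Taylor term at [a] is the p-th power of [h = \prod_i L i ^+ (w i %/ p)] times a remainder,
    and [T_b] pulls out [h]. Remainders take less than [p] of the degree per variable, hence the
    loss of [p * n]. *)
Lemma cartier_vanish b f g a m : (forall i, b i < p)%N ->
  cartier b f g -> vanish f a (p * (m + n)) -> vanish g a m.
Proof.
move=> ltb Hfg /vanish_expand[G [ordG Ef]].
suff [g' [Hg' vg']] : exists g', cartier b f g' /\ vanish g' a m.
  by rewrite (cartier_unique Hfg Hg').
rewrite Ef; have : {subset msupp G <= msupp G} by [].
elim: {1 3}(msupp G) => [|w l IHl] sl.
  exists 0; rewrite big_nil; split; first exact: cartier0.
  by rewrite /vanish rmorph0; apply: ordge0.
have [|g1 [Hg1 vg1]] := IHl.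
  by move=> x xl; apply: sl; rewrite inE xl orbT.
have wG : w \in msupp G by apply: sl; rewrite mem_head.
have le_w : (p * (m + n) <= mdeg w)%N.
  by rewrite leqNgt; apply: contraTN wG => /ordG E; rewrite mcoeff_msupp E eqxx.
pose L i : {mpoly F[n]} := 'X_i - (a i)%:MP.
pose h := \prod_i L i ^+ (w i %/ p).
pose f2 := G@_w *: \prod_i L i ^+ (w i %% p).
have [g2 Hg2] := cartier_exists b f2.
exists (h * g2 + g1); rewrite big_cons; split.
  apply: cartierD Hg1.
  have -> : G@_w *: \prod_i L i ^+ w i = h ^+ p * f2.
    rewrite /f2 -scalerAr; congr (_ *: _); rewrite /h -prodrXl -big_split /=.
    by apply: eq_bigr => i _; rewrite -exprM -exprD -divn_eq.
  exact: cartierM.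
rewrite /vanish rmorphD => u lt_u; rewrite mcoeffD [X in _ + X]vg1 // addr0.
suff vh : vanish h a m by rewrite mulrC; apply: (vanishMl g2 vh).
apply: (@vanishW _ _ _ _ (\sum_i w i %/ p)).
  rewrite -(leq_add2r n) -(leq_pmul2l p_gt0); apply: leq_trans le_w _.
  rewrite mdegE mulnDr big_distrr /= -[X in (_ + p * X)%N]card_ord mulnC.
  rewrite -sum_nat_const -big_split /=; apply: leq_sum => i _.
  by rewrite {1}(divn_eq (w i) p) mulnC leq_add2l ltnW // ltn_mod.
rewrite /h; elim/big_ind2: _ => [//|x1 x2 y1 y2 H1 H2|i _]; first exact: vanishM.
rewrite -[X in vanish _ _ X]mul1n; apply: vanishX; apply: vanish1P.
by rewrite mevalB mevalXU mevalC subrr.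
Qed.

(** With [b] the residues mod [p] of the leading exponent, [T_b f] is nonzero, and its exponents [v]
    satisfy [mdeg v * p + mdeg b = D]. *)
Lemma frobenius_descent f D : f != 0 -> f \is D.-homog ->
  exists g D', [/\ g != 0, g \is D'.-homog, (p * D' <= D)%N
    & forall a m, vanish f a (p * (m + n)) -> vanish g a m].
Proof.
move=> f0 hf; pose w := mlead f; have sw : w \in msupp f := mlead_supp f0.
pose b := [multinom (w i %% p)%N | i < n].
pose u := [multinom (w i %/ p)%N | i < n].
have Ew : w = (u *+ p + b)%MM.
  by apply/mnmP => i; rewrite mnmDE mulmnE !mnmE -divn_eq.
have ltb i : (b i < p)%N by rewrite mnmE ltn_mod.
have [g Hg] := cartier_exists b f.
have deg v : v \in msupp g -> (mdeg v * p + mdeg b)%N = D.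
  move=> sv; rewrite -mdegMn -mdegD; apply: (dhomog_mf hf).
  by rewrite mcoeff_msupp -Hg expf_neq0 // -mcoeff_msupp.
have su : u \in msupp g.
  move: sw; rewrite !mcoeff_msupp Ew -Hg; apply: contraNneq => ->.
  by rewrite expr0n gtn_eqF.
exists g, (mdeg u); split.
- by apply: contraTneq su => ->; rewrite msupp0.
- apply/dhomogP => v /deg /=; have := deg u su; nia.
- have := deg u su; lia.
- by move=> a m; apply: cartier_vanish Hg.
Qed.

End Frobenius.

(** * Forms of given degree and interpolation matrices *)

Section Monomials.
Variables (n D : nat).

Definition monomials : seq 'X_{1..n} :=
  [seq s2m t | t : D.-tuple 'I_n <- enum (basis n D)].

Definition monomial (i : 'I_(size monomials)) : 'X_{1..n} := nth 0%MM monomials i.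

Lemma mdeg_monomial i : mdeg (monomial i) = D.
Proof. by apply/eqP; rewrite basis_cover mem_nth. Qed.

Lemma monomial_inj : injective monomial.
Proof.
move=> i j /eqP; rewrite nth_uniq ?ltn_ord //; last exact: uniq_basis.
by move/eqP/val_inj.
Qed.

Lemma monomial_surj u : mdeg u = D -> exists i, u = monomial i.
Proof.
move/eqP; rewrite basis_cover => su.
have lt_i : (index u monomials < size monomials)%N by rewrite index_mem.
by exists (Ordinal lt_i); rewrite /monomial nth_index.
Qed.

Definition row_form (R : comNzRingType) (x : 'rV[R]_(size monomials)) : {mpoly R[n]} :=
  \sum_i x 0 i *: 'X_[monomial i].

Lemma row_form_homog (R : comNzRingType) (x : 'rV[R]_(size monomials)) :
  row_form x \is D.-homog.
Proof. by apply: rpred_sum => i _; apply: rpredZ; rewrite dhomogX /= mdeg_monomial. Qed.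

Lemma mcoeff_row_form (R : comNzRingType) (x : 'rV[R]_(size monomials)) i :
  (row_form x)@_(monomial i) = x 0 i.
Proof.
rewrite raddf_sum (bigD1 i) //= mcoeffZ mcoeffX eqxx mulr1 big1 ?addr0 // => j ne.
by rewrite mcoeffZ mcoeffX (inj_eq monomial_inj) (negbTE ne) mulr0.
Qed.

Lemma row_form_eq0 (R : comNzRingType) (x : 'rV[R]_(size monomials)) :
  row_form x = 0 -> x = 0.
Proof.
by move=> x0; apply/rowP => i; rewrite -mcoeff_row_form x0 mcoeff0 mxE.
Qed.

Lemma dhomog_row_form (R : comNzRingType) (f : {mpoly R[n]}) : f \is D.-homog ->
  f = row_form (\row_i f@_(monomial i)).
Proof.
move=> hf; apply/mpolyP => u.
have [/monomial_surj[i ->]|/eqP ne] := eqVneq (mdeg u) D.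
  by rewrite mcoeff_row_form mxE.
rewrite (dhomog_nemf_coeff hf) ?(dhomog_nemf_coeff (row_form_homog _)) //.
  exact/eqP.
exact/eqP.
Qed.

End Monomials.

Lemma size_monomials n D : size (monomials n.+1 D) = 'C(D + n, D).
Proof. exact: size_basis. Qed.

Lemma exists_form_through_points (k : fieldType) n s D (b : 'I_s -> 'I_n -> k) :
    (s < size (monomials n D))%N ->
  exists f : {mpoly k[n]}, [/\ f != 0, f \is D.-homog & forall i, f.@[b i] = 0].
Proof.
move=> lt_s.
pose A := \matrix_(i < size (monomials n D), j < s) 'X_[k, monomial i].@[b j].
have : kermx A != 0.
  rewrite kermx_eq0 /row_free; apply/negP => /eqP rA.
  by have := rank_leq_col A; rewrite rA leqNgt lt_s.
case/rowV0Pn => x /sub_kermxP xA x0; exists (row_form x); split.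
- by apply: contraNneq x0 => /row_form_eq0->.
- exact: row_form_homog.
- move=> j; have /rowP/(_ j) := xA; rewrite !mxE => <-.
  by rewrite raddf_sum; apply: eq_bigr => i _; rewrite /= mevalZ mxE.
Qed.

Section Interpolation.
Variables (n s D m : nat).

Local Notation cond := ('I_s * 'X_{1..n < m})%type.

(** A column is a point with an exponent of degree below [m], and the entry is the Taylor
    coefficient there. Any ring is allowed, so that generic, given and specialized points share one
    minor. *)
Definition condition (R : comNzRingType) (b : 'I_s -> 'I_n -> R)
    (i : 'I_(size (monomials n D))) (j : 'I_#|{: cond}|) : R :=
  (msubst (fun l => 'X_l + (b (enum_val j).1 l)%:MP) 'X_[monomial i])@_(enum_val j).2.

Definition interpolation_minor (R : comNzRingType) (b : 'I_s -> 'I_n -> R)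
    (c : 'I_(size (monomials n D)) -> 'I_#|{: cond}|) : R :=
  \det (\matrix_(i, j) condition b i (c j)).

Lemma eq_interpolation_minor (R : comNzRingType) (b b' : 'I_s -> 'I_n -> R) c :
  (forall i, b i =1 b' i) -> interpolation_minor b c = interpolation_minor b' c.
Proof.
move=> bb'; congr (\det _); apply/matrixP => i j; rewrite !mxE /condition.
by congr mcoeff; apply: eq_msubst => l; rewrite bb'.
Qed.

Lemma rmorph_interpolation_minor (R S : comNzRingType) (phi : {rmorphism R -> S}) b c :
  phi (interpolation_minor b c) = interpolation_minor (fun i l => phi (b i l)) c.
Proof.
rewrite /interpolation_minor -det_map_mx; congr (\det _); apply/matrixP => i j.
by rewrite !mxE /condition -mcoeff_map_mpoly map_translate map_mpolyX.
Qed.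

Lemma row_form_condition (R : comNzRingType) (b : 'I_s -> 'I_n -> R)
    (x : 'rV[R]_(size (monomials n D))) j :
  \sum_i x 0 i * condition b i j =
  (msubst (fun l => 'X_l + (b (enum_val j).1 l)%:MP) (row_form x))@_(enum_val j).2.
Proof.
rewrite rmorph_sum raddf_sum; apply: eq_bigr => i _.
by rewrite /= msubstZ mcoeffZ.
Qed.

Lemma interpolation_minor_neq0 (k : fieldType) (b : 'I_s -> 'I_n -> k) :
    (forall f : {mpoly k[n]}, f \is D.-homog ->
       (forall i, vanish f (b i) m) -> f = 0) ->
  exists c, interpolation_minor b c != 0.
Proof.
move=> H; pose A := \matrix_(i, j) condition b i j.
have rA : row_free A.
  rewrite -kermx_eq0; apply/rowV0P => x /sub_kermxP xA; apply: row_form_eq0.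
  apply: H => [|l u lt_u]; first exact: row_form_homog.
  have /rowP/(_ (enum_rank (l, BMultinom lt_u))) := xA.
  rewrite !mxE (eq_bigr (fun i => x 0 i * condition b i (enum_rank (l, BMultinom lt_u)))).
    by rewrite row_form_condition enum_rankK.
  by move=> i _; rewrite mxE.
have fA : row_full A^T by rewrite /row_full mxrank_tr.
exists (fullrankfun fA); have := fullrowsub_unit fA.
rewrite unitmxE unitfE -det_tr /interpolation_minor; congr (\det _ != 0).
by apply/matrixP => i j; rewrite !mxE.
Qed.

Lemma interpolation_minor_vanish (k : fieldType) (b : 'I_s -> 'I_n -> k) c
    (f : {mpoly k[n]}) : interpolation_minor b c != 0 ->
  f \is D.-homog -> (forall i, vanish f (b i) m) -> f = 0.
Proof.
move=> nz hf vf; rewrite (dhomog_row_form hf); set x := \row_i _.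
pose A := \matrix_(i, j) condition b i (c j).
have uA : A \in unitmx by rewrite unitmxE unitfE.
have xA : x *m A = 0.
  apply/rowP => j; rewrite !mxE.
  rewrite (eq_bigr (fun i => x 0 i * condition b i (c j))) => [|i _]; last first.
    by rewrite [A _ _]mxE.
  by rewrite row_form_condition -dhomog_row_form //; apply: vf; apply: bmdeg.
have -> : x = 0 by rewrite -(mulmxK uA x) xA mul0mx.
by rewrite /row_form big1 // => i _; rewrite mxE scale0r.
Qed.

End Interpolation.

(** * From one order of vanishing to all orders *)

Lemma eq_vanish (R : comNzRingType) n (f : {mpoly R[n]}) a a' m :
  a =1 a' -> vanish f a m -> vanish f a' m.
Proof.
move=> aa'; rewrite /vanish; congr ordge.
by apply: eq_msubst => i; rewrite aa'.
Qed.

Section GenericBound.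
Variables (k : fieldType) (n s m0 D0 : nat).
Hypothesis k0 : [pchar k] =i pred0.

Lemma generic_bound (b : 'I_s -> 'I_n.+1 -> k) c (f : {mpoly k[n.+1]}) D m :
    @interpolation_minor n.+1 s D0 m0 k b c != 0 ->
    f != 0 -> f \is D.-homog -> (0 < m)%N -> (forall i, vanish f (b i) m) ->
  (D0.+1 * m <= D * (m0 + n.+1))%N.
Proof.
move=> nz f0 hf m_gt0 vf; rewrite leqNgt; apply/negP => lt_m.
pose cs := [seq f@_u | u <- msupp f] ++
  [seq b i j | i <- enum 'I_s, j <- enum 'I_n.+1].
have [A [alpha [specA cov]]] := specializable_model cs k0.
have [bA EbA] : exists bA : 'I_s -> 'I_n.+1 -> A, forall i j, alpha (bA i j) = b i j.
  have ex i j : exists y, alpha y == b i j.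
    have [|y Ey] := cov (b i j); last by exists y; apply/eqP.
    by rewrite mem_cat orbC allpairs_f ?mem_enum.
  by exists (fun i j => xchoose (ex i j)) => i j; apply/eqP/(xchooseP (ex i j)).
have [fA EfA hfA] : exists2 fA : {mpoly A[n.+1]},
    map_mpoly alpha fA = f & fA \is D.-homog.
  have ex (u : 'X_{1..n.+1}) : exists y, (u \in msupp f) ==> (alpha y == f@_u).
    have [su|_] := boolP (u \in msupp f); last by exists 0.
    have [|y Ey] := cov f@_u; last by exists y; apply/implyP => _; apply/eqP.
    by rewrite mem_cat; apply/orP; left; apply/mapP; exists u.
  exists (\sum_(u <- msupp f) xchoose (ex u) *: 'X_[u]).
    rewrite raddf_sum [RHS]mpolyE big_seq [RHS]big_seq; apply: eq_bigr => u su.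
    rewrite /= map_mpolyZ map_mpolyX; congr (_ *: _).
    by have /implyP/(_ su)/eqP := xchooseP (ex u).
  rewrite big_seq; apply: rpred_sum => u su; apply: rpredZ.
  by rewrite dhomogX; apply/eqP; apply: (dhomog_mf hf).
pose w := mlead f.
(* The reduction keeps the minor and one coefficient of [f]; the bound [m * D < p] is what the final
   inequality contradicts. *)
have [|F [p [beta [chF ltp nzu kerb]]]] :=
    specA (interpolation_minor bA c * fA@_w) (m * D)%N.
  rewrite rmorphM mulf_neq0 //.
    rewrite rmorph_interpolation_minor; apply: contraNneq nz => <-.
    by apply/eqP; apply: eq_interpolation_minor => i j; rewrite EbA.
  by rewrite -mcoeff_map_mpoly EfA mleadc_eq0.
move: nzu; rewrite rmorphM mulf_eq0 negb_or rmorph_interpolation_minor.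
set bF := fun i l => beta (bA i l) => /andP[nzF].
rewrite -mcoeff_map_mpoly; set fF := map_mpoly beta fA => fw.
have fF0 : fF != 0 by apply: contraNneq fw => ->; rewrite mcoeff0.
have hfF : fF \is D.-homog.
  apply/dhomogP => u; rewrite mcoeff_msupp mcoeff_map_mpoly => nzu.
  apply: (dhomog_mf hfA); rewrite mcoeff_msupp.
  by apply: contraNneq nzu => E; rewrite /= E rmorph0.
have vfF i : vanish fF (bF i) m.
  move=> u lt_u; rewrite -map_translate mcoeff_map_mpoly; apply: kerb.
  rewrite -mcoeff_map_mpoly map_translate EfA -(vf i u lt_u).
  by congr mcoeff; apply: eq_msubst => j; rewrite EbA.
(* The least [j] with [j * m] above [p * (m0 + n.+1)]; it overshoots by at most [m]. *)
pose j := ((p * (m0 + n.+1)) %/ m).+1.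
have fj0 : fF ^+ j != 0 by rewrite expf_neq0.
have [g [D' [g0 hg le_D' vg]]] := frobenius_descent chF fj0 (dhomogMn j hfF).
have p_gt0 : (0 < p)%N := leq_ltn_trans (leq0n _) ltp.
have vgF i : vanish g (bF i) m0.
  have vj := vanishX (j := j) (vfF i).
  apply: vg; apply: vanishW vj.
  by rewrite [leqRHS]mulnC ltnW // -ltn_divLR.
(* The minor excludes forms of degree exactly [D0], so a [g] of smaller degree is first multiplied
   by a power of [X_0]. *)
have [le_D0|lt_D0] := leqP D' D0.
  have: 'X_ord0 ^+ (D0 - D') * g = 0.
    apply: (interpolation_minor_vanish nzF) => [|i]; last exact: vanishMl.
    have : 'X_ord0 ^+ (D0 - D') * g \is (D0 - D' + D').-homog.
      apply: dhomogM => //; rewrite -[X in X.-homog]mul1n; apply: dhomogMn.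
      by rewrite dhomogX /= mdeg1.
    by rewrite subnK.
  move/eqP; rewrite mulf_eq0 (negbTE g0) orbF expf_eq0 => /andP[_].
  by rewrite -msupp_eq0 msuppX.
have le_j : (j * m <= p * (m0 + n.+1) + m)%N.
  by rewrite /j mulSn addnC leq_add2r leq_divM.
have le1 : (p * (D0.+1 * m) <= D * (p * (m0 + n.+1) + m))%N.
  apply: leq_trans (leq_mul (leqnn D) le_j); rewrite !mulnA leq_pmul2r //.
  by apply: leq_trans le_D'; rewrite leq_pmul2l.
(* The assumed strict inequality has a gap of at least 1, which becomes [p] here, while [le1] leaves
   room for only [D * m]. *)
have le2 : (p * (D * (m0 + n.+1)).+1 <= p * (D0.+1 * m))%N by rewrite leq_pmul2l.
move: (leq_trans le2 le1) ltp; clear; move: (m0 + n.+1)%N => M; nia.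
Qed.

End GenericBound.

(** * Star points in characteristic zero *)

Lemma exists_star_points (k : fieldType) (r l s : nat) :
    [pchar k] =i pred0 -> ('C(l, r) <= s)%N ->
  exists (ts : seq k) (b : 'I_s -> 'I_r.+1 -> k), [/\ uniq ts, size ts = l
    & forall S, uniq S -> size S = r -> {subset S <= ts} ->
        exists i, b i =1 star_pt S].
Proof.
move=> /pcharf0P k0 le_s; pose t (j : 'I_l) : k := (val j)%:R.
have t_inj : injective t.
  have wlog_inj (i j : nat) : i%:R = j%:R :> k -> (i <= j)%N.
    rewrite leqNgt => E; apply/negP => lt_ji.
    have : (i - j)%:R == 0 :> k by rewrite natrB ?E ?subrr // ltnW.
    by rewrite k0 subn_eq0 leqNgt lt_ji.
  move=> i j E; apply/val_inj/eqP; rewrite eqn_leq.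
  by rewrite !wlog_inj // /t E.
pose draws := enum [set X : {set 'I_l} | #|X| == r].
have szd : size draws = 'C(l, r).
  by rewrite -cardE card_draws card_ord.
(* Indices beyond the ['C(l, r)] subsets get the default [set0]; the surplus points may be
   arbitrary. *)
exists [seq t j | j <- enum 'I_l],
  (fun i => star_pt [seq t j | j <- enum (nth set0 draws i)]); split.
- by rewrite map_inj_uniq ?enum_uniq.
- by rewrite size_map size_enum_ord.
move=> S uS szS sS; pose X := [set j | t j \in S].
have pS : perm_eq S [seq t j | j <- enum X].
  apply: uniq_perm => //; first by rewrite map_inj_uniq ?enum_uniq.
  move=> x; apply/idP/mapP => [xS|[j]]; last by rewrite mem_enum inE => tS ->.
  by have /mapP[j _ Ex] := sS x xS; exists j => //; rewrite mem_enum inE -Ex.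
have Xd : X \in draws.
  by rewrite mem_enum inE cardE -(size_map t) -(perm_size pS) szS.
have lt_i : (index X draws < s)%N by rewrite (leq_trans _ le_s) // -szd index_mem.
exists (Ordinal lt_i) => j; rewrite /star_pt /= nth_index //.
by rewrite (perm_big _ pS).
Qed.

(** * Least degrees and ideals of points *)

Section Alpha.
Variables (k : fieldType) (n : nat) (J : {mpoly k[n]} -> Prop).

Lemma alpha_predP d :
  alpha_pred J d <-> exists f : {mpoly k[n]}, J f /\ f != 0 /\ f \is d.-homog.
Proof. by rewrite /alpha_pred; case: excluded_middle_informative. Qed.

Lemma alpha_le d : alpha_pred J d -> (alpha J <= d)%N.
Proof.
move=> Jd; rewrite /alpha; case: excluded_middle_informative => // ex.
by case: ex_minnP => e _; apply.
Qed.

Lemma alpha_attained d : alpha_pred J d -> alpha_pred J (alpha J).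
Proof.
move=> Jd; rewrite /alpha; case: excluded_middle_informative => [ex|nex].
  by case: ex_minnP.
by case: nex; exists d.
Qed.

End Alpha.

Section PointIdeals.
Variables (k : fieldType).

Lemma point_ideal_vanish n (a : 'I_n -> k) f : point_ideal a f -> vanish f a 1.
Proof.
move=> fa; apply: vanish1P; rewrite [X in X.@[a]](pihomog_partitionE (leqnn (msize f))).
by rewrite raddf_sum big1 // => d _; apply: fa.
Qed.

Lemma ideal_pow_vanish n (a : 'I_n -> k) m f :
  ideal_pow (point_ideal a) m f -> vanish f a m.
Proof.
case=> l [c [g [Pg ->]]]; apply: vanish_sum => i _ _; apply: vanishMl.
have [h [Ph ->]] := Pg i.
suff : vanish (\prod_(j < m) h j) a (\sum_(j < m) 1)%N by rewrite sum1_card card_ord.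
elim/big_ind2: _ => [//|x1 x2 y1 y2 H1 H2|j _]; first exact: vanishM.
exact: point_ideal_vanish.
Qed.

Lemma point_ideal_homog n (a : 'I_n -> k) f d :
  f \is d.-homog -> f.@[a] = 0 -> point_ideal a f.
Proof.
move=> hf fa e; have [<-|ne] := eqVneq d e; first by rewrite pihomog_dE.
by rewrite (pihomog_ne0 ne hf) meval0.
Qed.

Lemma ideal_pow_exp n (P : {mpoly k[n]} -> Prop) m f :
  P f -> ideal_pow P m (f ^+ m).
Proof.
move=> Pf; exists 1%N, (fun _ => 1), (fun _ => f ^+ m); split.
  by move=> _; exists (fun _ => f); split=> //; rewrite prodr_const card_ord.
by rewrite big_ord1 mul1r.
Qed.

End PointIdeals.

(** * The inequality for general points *)

Theorem theorem5p8 (k : fieldType) (hchar : [pchar k] =i pred0)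
    (N s : nat) (hN : (3 <= N)%N) (hs : (1 <= s)%N) :
  @general_points k s N (fun a =>
    forall m : nat, (0 < m)%N ->
      ((alpha (points_ideal a) + N - 2)%N%:R / N%:R : rat)
        <= (alpha (sym_pow a m))%:R / m%:R).
Proof.
have [d le_s lt_s] : exists2 d, ('C(d + N, N) <= s)%N & (s < 'C(d.+1 + N, N))%N.
  have ex : exists d, (s < 'C(d + N, N))%N.
    exists s; case: N hN => // N' _; elim: (s) => [|s' IHs]; first by rewrite bin_gt0.
    by rewrite addSn binS; have := bin_gt0 (s' + N'.+1) N'; lia.
  case: (ex_minnP ex) => -[|d] lt_d min_d; first by move: lt_d; rewrite binn; lia.
  by exists d => //; rewrite leqNgt; apply/negP => /min_d; rewrite ltnn.
(* Here [m0 + N.+1 = l * N.+1], so [m0 / (m0 + N.+1) = (l - 1) / l] is just the loss from [l / N] to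
   [(l - 1) / N]. [D0] is the largest degree with [N * D0 < l * m0], which the star bound
   excludes. *)
pose l := (d + N)%N; pose m0 := (l.-1 * N.+1)%N; pose D0 := ((m0 * l).-1 %/ N)%N.
have l_gt1 : (1 < l)%N by rewrite /l; lia.
have m0l_gt0 : (0 < m0 * l)%N.
  by rewrite /m0 !muln_gt0 (ltnW l_gt1) !andbT -subn1 subn_gt0.
have ltN : (m0 * l <= D0.+1 * N)%N.
  by rewrite -(prednK m0l_gt0) -ltn_divLR //; lia.
have leN : (N * D0 < l * m0)%N.
  by rewrite [ltnRHS]mulnC -(prednK m0l_gt0) ltnS mulnC leq_divM.
have [ts [bstar [uts szts Hstar]]] := exists_star_points hchar le_s.
have [c nz_star] : exists c, @interpolation_minor N.+1 s D0 m0 k bstar c != 0.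
  apply: interpolation_minor_neq0 => f hf vf; apply/eqP; apply: contraLR leN => f0.
  rewrite -leqNgt /l -szts; have := @star_bound _ N D0 ts (fun _ => 0%N) m0 f uts.
  rewrite szts leq_addl => /(_ isT f0 hf).
  rewrite big1 // addn0 gtn_eqF; last lia.
  apply=> S uS szS sS; have [i Ei] := Hstar S uS szS sS.
  by rewrite big1 // subn0; apply: eq_vanish Ei _.
(* At points with variables as coordinates the minor is a polynomial [g] on the parameter space; it
   is nonzero at the star points. *)
pose bgen (i : 'I_s) (j : 'I_N.+1) : {mpoly k[s * N.+1]} := 'X_(mxvec_index i j).
pose g := interpolation_minor bgen c.
have gE v : g.@[v] = interpolation_minor (pt v) c.
  rewrite (rmorph_interpolation_minor (meval v)).
  by apply: eq_interpolation_minor => i j; rewrite /= mevalXU.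
exists (fun v => g.@[v] != 0); split; [|split].
- by exists (fun h => h = g) => v; split=> [nz|[h [-> //]]]; exists g.
- pose B := \matrix_(i < s, j < N.+1) bstar i j.
  exists (fun j => mxvec B 0 j); rewrite gE; apply: contraNneq nz_star => <-.
  by apply/eqP; apply: eq_interpolation_minor => i j; rewrite /pt mxvecE mxE.
move=> a; rewrite gE => nz m m_gt0.
have [|f [f0 hf fa]] := @exists_form_through_points k N.+1 s d.+1 (pt a).
  by rewrite size_monomials -bin_sub ?leq_addr // addnC addnK addnC.
have If : points_ideal a f by move=> i; apply: point_ideal_homog hf (fa i).
have le_alpha : (alpha (points_ideal a) <= d.+1)%N.
  by apply: alpha_le; apply/alpha_predP; exists f.
(* The power [f ^+ m] ensures that [alpha (sym_pow a m)] is attained and not the default 0. *)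
have : alpha_pred (sym_pow a m) (d.+1 * m).
  apply/alpha_predP; exists (f ^+ m); split; [|split].
  - by move=> i; apply: ideal_pow_exp.
  - by rewrite expf_neq0.
  - exact: dhomogMn.
move=> /alpha_attained /alpha_predP[h [Ih [h0 hh]]].
have := generic_bound hchar nz h0 hh m_gt0 (fun i => ideal_pow_vanish (Ih i)).
set D := alpha (sym_pow a m) => bound.
rewrite ler_pdivrMr ?ltr0n ?(leq_trans _ hN) // mulrAC ler_pdivlMr ?ltr0n //.
rewrite -!natrM ler_nat.
have le_l : (alpha (points_ideal a) + N - 2 <= l.-1)%N by rewrite /l; lia.
apply: leq_trans (leq_mul le_l (leqnn m)) _.
have Em0 : (m0 + N.+1 = l * N.+1)%N by rewrite /m0 -mulSnr prednK // ltnW.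
rewrite {}Em0 in bound.
have lN_gt0 : (0 < l * N.+1)%N by rewrite muln_gt0 ltnW.
(* The factor [l * N.+1] turns [l.-1 * m] into [m0 * l * m], to which [ltN] and then [bound]
   apply. *)
rewrite -(leq_pmul2r lN_gt0).
apply: (@leq_trans (m0 * l * m)%N); first by apply/eq_leq; rewrite /m0; ring.
apply: leq_trans (leq_mul ltN (leqnn m)) _.
by rewrite mulnAC [leqRHS]mulnAC leq_mul2r bound orbT.
Qed.
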